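(* Let $q$ be a prime power, let $\alpha\in\mathbb{F}_{q^2}$ be an algebraic element of degree $2$ over $\mathbb{F}_q$, let $\theta$ be a primitive element of $\mathbb{F}_{q^2}$, and let $$\mathcal{B}(q,\theta,\alpha)=\{\log_\theta(\alpha+a) : a\in\mathbb{F}_q\}\subseteq\mathbb{Z}_{q^2-1}.$$ The function $f:[1,q]\to\mathbb{Z}_{q-1}$ defined by $$f(i):=\left\lfloor\frac{b_i}{q+1}\right\rfloor,$$ where $b_i\in\mathcal{B}(q,\theta,\alpha)$ is the unique element such that $b_i\equiv i\pmod{q+1}$, is a $(q-1)\times q$ modular sonar sequence.
   Context: For integers $a\le c$, $[a,c]$ denotes $\{a,a+1,\ldots,c\}$. $\mathbb{F}_q$ is the finite field with $q$ elements. A primitive element of $\mathbb{F}_{q^2}$ is a generator of the cyclic group $\mathbb{F}_{q^2}^*$. For $x\in\mathbb{F}_{q^2}^*$, $\log_\theta(x)$ is the discrete logarithm, i.e. the unique element $k$ of $\mathbb{Z}_{q^2-1}$ with $\theta^k=x$, represented by an integer in $[0,q^2-2]$. $\lfloor y\rfloor$ is the largest integer less than or equal to $y$. Modular sonar sequence: an $m\times n$ modular sonar sequence is a function $f:[1,n]\to\mathbb{Z}_m$ such that for all integers $h,i,j$ with $1\le h\le n-1$ and $1\le i,j\le n-h$, $f(i+h)-f(i)\equiv f(j+h)-f(j)\pmod m$ implies $i=j$. *)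

(* Defs.v *)
From HB Require Import structures.
From mathcomp Require Import all_boot all_order all_fingroup all_algebra.
From mathcomp Require Import all_solvable all_field.

Set Implicit Arguments.
Unset Strict Implicit.
Unset Printing Implicit Defensive.

Import GRing.Theory.

Local Open Scope ring_scope.

(* Only the values of f on [1, n] matter.  The elements of Z_m are represented
   by the naturals 0, ..., m - 1 and compared by integer congruences; the type
   'Z_m is avoided because 'Z_1 is Z/2. *)
Definition modular_sonar_sequence (m n : nat) (f : nat -> nat) : Prop :=
  (forall i : nat, (1 <= i <= n)%N -> (f i < m)%N) /\
  (forall h i j : nat,
     (1 <= h <= n - 1)%N -> (1 <= i <= n - h)%N -> (1 <= j <= n - h)%N ->
     ((f (i + h)%N)%:Z - (f i)%:Z = (f (j + h)%N)%:Z - (f j)%:Z %[mod m%:Z])%Z ->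
     i = j).

(* For E of order q^2 >= 4 the index type has exactly #|E| - 1 elements, the
   integers in [0, q^2 - 2].  When theta generates the group of units of E and
   x != 0 the [pick ...] succeeds and its value is unique; otherwise the value
   is irrelevant. *)
Definition dlog (E : finFieldType) (theta : {unit E}) (x : E) : 'Z_(#|E|.-1) :=
  odflt 0 [pick k : 'Z_(#|E|.-1) | FinRing.uval theta ^+ k == x].

Section Bose.

(* finvect_type L is L itself, equipped with its finite field structure. *)
Variables (F : finFieldType) (L : fieldExtType F).
Variables (theta : {unit finvect_type L}) (alpha : L).

Definition bose_set : {set 'Z_(#|finvect_type L|.-1)} :=
  [set dlog theta (alpha + a%:A : L) | a : F].

(* The representative in [0, q^2 - 2] of the element of bose_set congruent to i
   modulo q + 1 (0 if there is none). *)
Definition bose_elt (i : nat) : nat :=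
  odflt 0 [pick b in bose_set | b == i %[mod #|F|.+1]].

Definition bose_sonar (i : nat) : nat := (bose_elt i %/ #|F|.+1)%N.

End Bose.

(* Main.v *)
Require Import Defs.
From HB Require Import structures.
From mathcomp Require Import all_boot all_order all_fingroup all_algebra.
From mathcomp Require Import all_solvable all_field.
From mathcomp Require Import ring zify.

Set Implicit Arguments.
Unset Strict Implicit.
Unset Printing Implicit Defensive.

Import GRing.Theory.

Local Open Scope ring_scope.

(** The powers of theta of exponent divisible by q + 1 are the nonzero scalars,
    so reducing a logarithm modulo q + 1 amounts to looking at the line spanned
    over F_q.  The q elements alpha + a span pairwise distinct lines, all
    different from F_q itself because alpha is not a scalar
    ([translate_scale_inj]).  Their logarithms are therefore q distinct nonzero
    residues modulo q + 1, which leaves exactly one for each i in [1, q]: this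
    is the element b_i.

    The set of logarithms is moreover a Sidon set modulo q^2 - 1.  An equality
    (alpha + x)(alpha + y) = (alpha + z)(alpha + w) loses its term alpha^2, and
    since 1 and alpha are independent it leaves x + y = z + w and x y = z w,
    whence {x, y} = {z, w} ([translate_mul_inj]).

    Finally b_i = (q + 1) f(i) + i.  Multiplying by q + 1 a congruence modulo
    q - 1 between f(i + h) - f(i) and f(j + h) - f(j), and adding h on both
    sides, gives b_(i+h) - b_i = b_(j+h) - b_j modulo q^2 - 1.  The Sidon
    property then makes b_(i+h) equal to b_(j+h) or to b_i, and comparing
    residues modulo q + 1 gives i = j in the first case and h = 0, which is
    excluded, in the second. *)

(** * Scalars and translates in a quadratic extension *)

(** The polynomial X^q - X already splits over F with all of F as roots, so
    it has no further root in an extension. *)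
Lemma expf_card_scalar (F : finFieldType) (L : fieldExtType F) (x : L) :
  x ^+ #|F| = x -> exists c : F, x = c%:A.
Proof.
move=> xq.
have : root (map_poly (in_alg L) ('X^#|F| - 'X)) x.
  by rewrite rmorphB /= map_polyXn map_polyX rootE !hornerE xq subrr.
rewrite finField_genPoly rmorph_prod rootE horner_prod prodf_seq_eq0.
case/hasP => c _; rewrite /= map_polyXsubC hornerXsubC subr_eq0 => /eqP ->.
by exists c.
Qed.

Lemma adjoin_degree2_nonscalar (F : fieldType) (L : fieldExtType F)
    (alpha : L) :
  adjoin_degree 1%AS alpha = 2%N -> forall c : F, alpha != c%:A.
Proof.
move=> deg2 c; apply: contra_eq_neq deg2 => ->.
by have /eqP -> : adjoin_degree 1%AS (c%:A : L) == 1%N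
  by rewrite adjoin_deg_eq1 rpredZ ?rpred1.
Qed.

Lemma nonscalar_translate_neq0 (F : fieldType) (L : fieldExtType F)
    (alpha : L) (a : F) :
  (forall c : F, alpha != c%:A) -> alpha + a%:A != 0.
Proof. by move=> nsc; rewrite addr_eq0 -scaleNr nsc. Qed.

Lemma nonscalar_free (F : fieldType) (L : fieldExtType F)
    (alpha : L) (u v : F) :
  (forall c : F, alpha != c%:A) -> u *: alpha + v%:A = 0 -> u = 0 /\ v = 0.
Proof.
move=> nsc uv0; have u0 : u = 0.
  apply: contra_eq uv0 => u_neq0; apply: contra (nsc (- (u^-1 * v))) => /eqP uv0.
  rewrite scaleNr -addr_eq0 -scalerA -{1}[alpha](scalerK u_neq0) -scalerDr uv0.
  by rewrite scaler0.
split=> //; apply/eqP; move/eqP: uv0.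
by rewrite u0 scale0r add0r scaler_eq0 oner_eq0 orbF.
Qed.

(** Comparing the coefficients of alpha forces c = 1. *)
Lemma translate_scale_inj (F : fieldType) (L : fieldExtType F)
    (alpha : L) (a b c : F) :
  (forall d : F, alpha != d%:A) ->
  alpha + a%:A = c *: (alpha + b%:A) -> a = b.
Proof.
move=> nsc e.
have [] := @nonscalar_free F L alpha (1 - c) (a - c * b) nsc.
  rewrite !scalerBl scale1r -scalerA addrACA -opprD -scalerDr e.
  exact: subrr.
move/subr0_eq => <-; rewrite mul1r; exact: subr0_eq.
Qed.

(** The two products differ by a linear polynomial in alpha, whose vanishing
    says that x, y and z, w have the same sum and the same product; then x is a
    root of (X - z)(X - w). *)
Lemma translate_mul_inj (F : fieldType) (L : fieldExtType F)
    (alpha : L) (x y z w : F) :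
  (forall d : F, alpha != d%:A) ->
  (alpha + x%:A) * (alpha + y%:A) = (alpha + z%:A) * (alpha + w%:A) ->
  x = z \/ x = w.
Proof.
move=> nsc e.
have expand (s t : F) : (alpha + s%:A) * (alpha + t%:A)
    = alpha ^+ 2 + ((s + t) *: alpha + (s * t)%:A).
  by rewrite -[_ *: alpha]mulr_algl -!in_algE rmorphD rmorphM; ring.
move: e; rewrite !expand => /addrI /eqP.
rewrite -subr_eq0 opprD addrACA -!scalerBl => /eqP /(nonscalar_free nsc) [].
move=> /subr0_eq sumE /subr0_eq prodE.
have : (x - z) * (x - w) = 0.
  have yE : y = z + w - x by rewrite -sumE addrAC subrr add0r.
  transitivity (z * w - x * (z + w - x)); first by ring.
  by rewrite -yE prodE subrr.
by move/eqP; rewrite mulf_eq0 !subr_eq0 => /orP[] /eqP; [left | right].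
Qed.

(** * Discrete logarithms *)

Lemma order_generator_unit (E : finFieldType) (theta : {unit E}) :
  generator [set: {unit E}] theta -> #[theta]%g = #|E|.-1.
Proof. by move=> /eqP gen; rewrite /order -gen card_finField_unit. Qed.

Lemma eq_unit_expf (E : finFieldType) (theta : {unit E}) (k l : nat) :
  generator [set: {unit E}] theta ->
  (FinRing.uval theta ^+ k == FinRing.uval theta ^+ l)
    = (k == l %[mod #|E|.-1])%N.
Proof.
move=> gen; rewrite -(order_generator_unit gen) -eq_expg_mod_order.
by rewrite -!FinRing.val_unitX.
Qed.

Lemma dlogK (E : finFieldType) (theta : {unit E}) (x : E) :
  generator [set: {unit E}] theta -> x != 0 ->
  FinRing.uval theta ^+ dlog theta x = x.
Proof.
move=> gen x0; rewrite /dlog; case: pickP => [k /eqP // | none].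
have xU : x \is a GRing.unit by rewrite unitfE.
have : FinRing.Unit xU \in <[theta]>%g by rewrite -(eqP gen) inE.
case/cycleP => n thn.
(* The exponent n is reduced modulo the order to fit in the range of [pick]. *)
have ltn : (n %% #|E|.-1 < (Zp_trunc #|E|.-1).+2)%N.
  apply: leq_trans (ltn_pmod n _) _; last by rewrite /Zp_trunc; lia.
  by rewrite -(order_generator_unit gen) order_gt0.
have := none (Ordinal ltn); rewrite /=.
have -> : FinRing.uval theta ^+ (n %% #|E|.-1)%N = FinRing.uval theta ^+ n.
  by apply/eqP; rewrite eq_unit_expf // modn_mod.
by rewrite -FinRing.val_unitX -thn eqxx.
Qed.

(** Let y be the quotient of the two powers.  The exponent of theta in y^(q-1)
    is a multiple of (q + 1)(q - 1), the order of theta, so y^q = y and y is a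
    scalar. *)
Lemma generator_expf_scalar (F : finFieldType) (L : fieldExtType F)
    (theta : {unit finvect_type L}) (k l : nat) :
  #|finvect_type L| = (#|F| ^ 2)%N ->
  generator [set: {unit finvect_type L}] theta ->
  (k = l %[mod #|F|.+1])%N ->
  exists c : F, (FinRing.uval theta : L) ^+ k
              = c *: (FinRing.uval theta : L) ^+ l.
Proof.
move=> cardL gen kl; set t : L := FinRing.uval theta.
have t0 : t != 0 by rewrite -unitfE; exact: (valP theta).
have [c cE] : exists c : F, t ^+ k / t ^+ l = c%:A.
  apply: expf_card_scalar; apply/eqP.
  rewrite expr_div_n eqr_div ?expf_neq0 // -!exprM -!exprD.
  rewrite (@eq_unit_expf (finvect_type L)) // cardL.
  have q_gt1 := finNzRing_gt1 F.
  have -> : (#|F| ^ 2).-1 = ((#|F| - 1) * #|F|.+1)%N by nia.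
  have -> : (k * #|F| + l = (#|F| - 1) * k + (k + l))%N
    by case: #|F| q_gt1 => // n _; rewrite subn1 /=; ring.
  have -> : (k + l * #|F| = (#|F| - 1) * l + (k + l))%N
    by case: #|F| q_gt1 => // n _; rewrite subn1 /=; ring.
  by rewrite eqn_modDr -!muln_modr kl.
by exists c; rewrite -mulr_algl -cE divfK // expf_neq0.
Qed.

(** * Residues of the Bose set *)

Lemma translate_dlogK (F : finFieldType) (L : fieldExtType F) (alpha : L)
    (theta : {unit finvect_type L}) (a : F) :
  (forall c : F, alpha != c%:A) ->
  generator [set: {unit finvect_type L}] theta ->
  (FinRing.uval theta : L) ^+ dlog theta (alpha + a%:A : L)%R = alpha + a%:A.
Proof.
move=> nsc gen.
exact: (@dlogK (finvect_type L) theta (alpha + a%:A) gen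
          (nonscalar_translate_neq0 a nsc)).
Qed.

(** Logarithms congruent modulo q + 1 belong to proportional translates. *)
Lemma translate_dlog_mod_inj (F : finFieldType) (L : fieldExtType F)
    (alpha : L) (theta : {unit finvect_type L}) (a b : F) :
  #|finvect_type L| = (#|F| ^ 2)%N ->
  (forall c : F, alpha != c%:A) ->
  generator [set: {unit finvect_type L}] theta ->
  (dlog theta (alpha + a%:A : L)%R = dlog theta (alpha + b%:A : L)%R
     %[mod #|F|.+1])%N ->
  a = b.
Proof.
move=> cardL nsc gen /(generator_expf_scalar cardL gen) [c].
by rewrite !translate_dlogK //; apply: translate_scale_inj.
Qed.

(** A logarithm divisible by q + 1 would make alpha + a a scalar. *)
Lemma translate_dlog_mod_neq0 (F : finFieldType) (L : fieldExtType F)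
    (alpha : L) (theta : {unit finvect_type L}) (a : F) :
  #|finvect_type L| = (#|F| ^ 2)%N ->
  (forall c : F, alpha != c%:A) ->
  generator [set: {unit finvect_type L}] theta ->
  (dlog theta (alpha + a%:A : L)%R %% #|F|.+1 != 0)%N.
Proof.
move=> cardL nsc gen; apply/eqP; rewrite -(mod0n #|F|.+1).
move=> /(generator_expf_scalar cardL gen) [c].
rewrite translate_dlogK // expr0 => e.
by have /eqP := nsc (c - a); apply; rewrite scalerBl -e addrK.
Qed.

(** The map sending a to the residue is an injection from F, which has q
    elements, into the q nonzero residues, so it is onto. *)
Lemma translate_dlog_mod_onto (F : finFieldType) (L : fieldExtType F)
    (alpha : L) (theta : {unit finvect_type L}) (i : nat) :
  #|finvect_type L| = (#|F| ^ 2)%N ->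
  (forall c : F, alpha != c%:A) ->
  generator [set: {unit finvect_type L}] theta ->
  (1 <= i <= #|F|)%N ->
  exists a : F, (dlog theta (alpha + a%:A : L)%R %% #|F|.+1)%N = i.
Proof.
move=> cardL nsc gen /andP[i_gt0 i_le].
pose res (a : F) : 'I_#|F|.+1 := inord (dlog theta (alpha + a%:A : L)%R %% #|F|.+1).
have resE a : res a = (dlog theta (alpha + a%:A : L)%R %% #|F|.+1)%N :> nat.
  by rewrite inordK // ltn_pmod.
have res_inj : injective res.
  move=> a b /(congr1 val) /=; rewrite !resE.
  exact: translate_dlog_mod_inj.
have sub : [set res a | a : F] \subset [set~ ord0].
  apply/subsetP => _ /imsetP[a _ ->]; rewrite !inE -val_eqE /= resE.
  exact: translate_dlog_mod_neq0.
have : inord i \in [set res a | a : F].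
  have /eqP -> : [set res a | a : F] == [set~ ord0].
    by rewrite eqEcard sub cardsC1 card_ord card_imset //= leqnn.
  by rewrite !inE -val_eqE /= inordK // -lt0n.
by case/imsetP => a _ ia; exists a; rewrite -resE -ia inordK.
Qed.

(** Sidon property: exponentiating the congruence gives an equality of two
    products of translates of alpha. *)
Lemma translate_dlog_sidon (F : finFieldType) (L : fieldExtType F)
    (alpha : L) (theta : {unit finvect_type L}) (x y z w : F) :
  (forall c : F, alpha != c%:A) ->
  generator [set: {unit finvect_type L}] theta ->
  (dlog theta (alpha + x%:A : L)%R + dlog theta (alpha + y%:A : L)%R
   = dlog theta (alpha + z%:A : L)%R + dlog theta (alpha + w%:A : L)%R
     %[mod #|finvect_type L|.-1])%N ->
  x = z \/ x = w.
Proof.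
move=> nsc gen /eqP.
rewrite -(@eq_unit_expf (finvect_type L) theta) // => /eqP.
rewrite -[LHS]/((FinRing.uval theta : L) ^+ _).
rewrite -[RHS]/((FinRing.uval theta : L) ^+ _).
rewrite !exprD !(translate_dlogK _ nsc gen).
exact: translate_mul_inj.
Qed.

(** * The sonar sequence *)

Lemma mem_bose_set (F : finFieldType) (L : fieldExtType F)
    (alpha : L) (theta : {unit finvect_type L}) (a : F) :
  dlog theta (alpha + a%:A : L) \in bose_set theta alpha.
Proof. exact: imset_f. Qed.

(** The quotient and remainder of b_i modulo q + 1 are f(i) and i.  This is the
    form in which congruences on f become congruences on logarithms. *)
Lemma bose_sonar_divn_eq (F : finFieldType) (L : fieldExtType F)
    (alpha : L) (theta : {unit finvect_type L}) (i : nat) :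
  #|finvect_type L| = (#|F| ^ 2)%N ->
  (forall c : F, alpha != c%:A) ->
  generator [set: {unit finvect_type L}] theta ->
  (1 <= i <= #|F|)%N ->
  exists a : F, (bose_sonar theta alpha i * #|F|.+1 + i)%N
                = dlog theta (alpha + a%:A : L)%R.
Proof.
move=> cardL nsc gen ib.
have i_small : (i %% #|F|.+1)%N = i by rewrite modn_small; lia.
rewrite /bose_sonar /bose_elt; case: pickP => [b /andP[] | none].
  case/imsetP => a _ -> /eqP e; exists a.
  by rewrite -[X in (_ + X)%N]i_small -e -divn_eq.
have [a ai] := translate_dlog_mod_onto cardL nsc gen ib.
have := none (dlog theta (alpha + a%:A : L)%R).
by rewrite mem_bose_set /= ai i_small eqxx.
Qed.

Theorem corollary1 (q : nat)
  (hq : exists p k : nat, [/\ prime p, (0 < k)%N & q = (p ^ k)%N])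
  (F : finFieldType) (hF : #|F| = q)
  (L : fieldExtType F) (hL : #|finvect_type L| = (q ^ 2)%N)
  (alpha : L) (halpha : adjoin_degree 1%AS alpha = 2%N)
  (theta : {unit finvect_type L})
  (htheta : generator [set: {unit finvect_type L}] theta) :
  (forall i : nat, (1 <= i <= q)%N ->
     exists! b : 'Z_(#|finvect_type L|.-1),
       b \in bose_set theta alpha /\ (b = i %[mod q.+1])%N) /\
  modular_sonar_sequence (q - 1) q (bose_sonar theta alpha).
Proof.
subst q; have nsc := adjoin_degree2_nonscalar halpha; clear hq.
have q_gt1 := finNzRing_gt1 F.
split=> [i ib|].
  have [a ai] := translate_dlog_mod_onto hL nsc htheta ib.
  have i_small : (i %% #|F|.+1)%N = i by rewrite modn_small; lia.
  exists (dlog theta (alpha + a%:A : L)%R); split.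
    by rewrite mem_bose_set i_small.
  move=> _ [/imsetP[b _ ->] bi]; congr (dlog theta (alpha + _%:A : L)%R).
  by apply: (translate_dlog_mod_inj hL nsc htheta); rewrite ai bi.
pose f := bose_sonar theta alpha.
have fE (i : nat) : (1 <= i <= #|F|)%N -> exists a : F,
    (f i * #|F|.+1 + i)%N = dlog theta (alpha + a%:A : L)%R.
  exact: bose_sonar_divn_eq.
have modE : (#|finvect_type L|.-1 = (#|F| - 1) * #|F|.+1)%N by rewrite hL; nia.
split=> [i /fE[a fi] | h i j hb ib jb /eqP].
  have : (dlog theta (alpha + a%:A : L)%R < #|finvect_type L|.-1)%N.
    have N_gt1 : (1 < #|finvect_type L|.-1)%N.
      rewrite modE (leq_trans _ (leq_pmull _ _)) ?subn_gt0 // ltnS.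
      exact: ltnW.
    by rewrite -[X in (_ < X)%N](Zp_cast N_gt1); apply: ltn_ord.
  rewrite -fi modE => /(leq_ltn_trans (leq_addr _ _)).
  by rewrite ltn_pmul2r.
(* Adding f i + f j to both sides avoids subtraction. *)
rewrite -(eqz_modDr ((f i)%:Z + (f j)%:Z)) addrA subrK.
have -> : (f (j + h)%N)%:Z - (f j)%:Z + ((f i)%:Z + (f j)%:Z)
    = (f (j + h)%N)%:Z + (f i)%:Z by ring.
rewrite -!PoszD !modz_nat eqz_nat => /eqP sum_mod.
have [x ix] := fE (i + h)%N ltac:(lia).
have [y jy] := fE j ltac:(lia).
have [z jz] := fE (j + h)%N ltac:(lia).
have [w iw] := fE i ltac:(lia).
have f_inj (k l : nat) : (1 <= k <= #|F|)%N -> (1 <= l <= #|F|)%N ->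
    (f k * #|F|.+1 + k = f l * #|F|.+1 + l)%N -> k = l.
  move=> kb lb /(congr1 (modn^~ #|F|.+1)).
  by rewrite !modnMDl !modn_small; lia.
case: (@translate_dlog_sidon F L alpha theta x y z w nsc htheta) => [|xz|xw].
- rewrite -ix -jy -jz -iw modE.
  have regroup (k l : nat) : (f (k + h) * #|F|.+1 + (k + h) + (f l * #|F|.+1 + l)
      = (f (k + h) + f l) * #|F|.+1 + (k + l + h))%N by ring.
  rewrite !regroup (addnC j i).
  by apply/eqP; rewrite eqn_modDr -!muln_modl sum_mod.
- have /f_inj : (f (i + h) * #|F|.+1 + (i + h)
      = f (j + h) * #|F|.+1 + (j + h))%N by rewrite ix jz xz.
  lia.
- have /f_inj : (f (i + h) * #|F|.+1 + (i + h)
      = f i * #|F|.+1 + i)%N by rewrite ix iw xw.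
  lia.
Qed.
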